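(* Let $L$ be a locally compact Hausdorff space and $X=C_0(L)$. Then the following are equivalent. (a) The identity mapping $I:(B_{X^*},w^* )\to (B_{X^*},w)$ is continuous at every point of $\mathrm{ext}(B_{X^*})$. (b) $L$ is a discrete space.
   Context: Scalars are real. $C_0(L)$ is the Banach space of real continuous functions on $L$ vanishing at infinity, with the sup norm. $B_{X^*}$ is the closed unit ball of $X^*$, $\mathrm{ext}(B_{X^*})$ its set of extreme points, and $w^*$, $w$ are the (relative) weak-$*$ and weak topologies. *)

(* Defs.v *)
From HB Require Import structures.
From mathcomp Require Import all_boot all_order all_algebra.
From mathcomp Require Import all_classical all_reals all_analysis.

Set Implicit Arguments.
Unset Strict Implicit.
Unset Printing Implicit Defensive.

Import Order.TTheory GRing.Theory Num.Theory.
Import numFieldNormedType.Exports.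

Local Open Scope classical_set_scope.
Local Open Scope ring_scope.

Section C0_def.
Variables (R : realType) (L : topologicalType).

Definition vanishes_at_infinity (f : L -> R^o) :=
  forall e : R, 0 < e -> compact [set x | e <= `|f x|].

Definition C0_pred : {pred L -> R^o} :=
  mem [set f : L -> R^o | continuous f /\ vanishes_at_infinity f].

Record C0 := MkC0 {
  C0_val :> L -> R^o;
  C0_valP : C0_val \in C0_pred }.

HB.instance Definition _ := [isSub for C0_val].
HB.instance Definition _ := [Choice of C0 by <:].

Lemma C0_continuous (f : C0) : continuous f.
Proof. by case: f => f /= /set_mem[]. Qed.

Lemma C0_vanishes (f : C0) : vanishes_at_infinity f.
Proof. by case: f => f /= /set_mem[]. Qed.

Lemma closed_norm_ge (f : L -> R^o) (e : R) :
  continuous f -> closed [set x | e <= `|f x|].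
Proof.
move=> cf; apply: (@preimage_closed _ _ (fun x => `|f x|) [set y | e <= y]).
  by move=> x _; apply: continuous_comp; [exact: cf|exact: norm_continuous].
exact: closed_ge.
Qed.

Lemma C0_submod_closed : submod_closed C0_pred.
Proof.
split.
  apply/mem_set; split; first by move=> x; exact: cvg_cst.
  move=> e e0; rewrite (_ : [set _ | _] = set0); first exact: compact0.
  by rewrite -subset0 => x /=; rewrite normr0 leNgt e0.
move=> a f g /set_mem[cf vf] /set_mem[cg vg]; apply/mem_set.
have ch : continuous (a *: f + g : L -> R^o).
  by move=> x; apply: cvgD; [apply: cvgZl_tmp; exact: cf|exact: cg].
split=> // e e0.
have d0 : 0 < e / 2 / (`|a| + 1) by rewrite !divr_gt0// ltr_wpDl.
have e20 : 0 < e / 2 by rewrite divr_gt0.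
apply: (subclosed_compact _ (compactU (vf _ d0) (vg _ e20))).
  exact: closed_norm_ge.
move=> x /= ex; case: (leP (e / 2) `|g x|) => gx; [by right|left].
rewrite leNgt; apply/negP => fx; move: ex; apply/negP; rewrite -ltNge.
apply: (le_lt_trans (ler_normD _ _)).
rewrite [ltRHS](splitr e) ler_ltD//.
rewrite normrZ (@le_trans _ _ ((`|a| + 1) * `|f x|))//.
  by rewrite ler_wpM2r// lerDl.
by rewrite -ler_pdivlMl 1?mulrC ?ltr_wpDl// ltW.
Qed.

HB.instance Definition _ := GRing.isSubmodClosed.Build _ _ C0_pred
  C0_submod_closed.
HB.instance Definition _ := [SubChoice_isSubLmodule of C0 by <:].

(** If [L] is empty then [C0] is trivial and [sup set0 = 0]. *)
Definition sup_norm (f : C0) : R := sup [set `|f x| | x in [set: L]].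

Lemma C0_has_ubound (f : C0) : has_ubound [set `|f x| | x in [set: L]].
Proof.
have /compact_bounded[M [Mr MP]] :
    compact (f @` [set x | 1 <= `|f x|]).
  apply: continuous_compact; last exact: C0_vanishes.
  exact/continuous_subspaceT/C0_continuous.
exists (Num.max 1 (M + 1)) => _ [x _ <-]; rewrite le_max.
case: (leP `|f x| 1) => //= fx.
by apply: (MP (M + 1)); [rewrite ltrDl|exists x => //=; exact: ltW].
Qed.

Lemma sup_norm_ge (f : C0) x : `|f x| <= sup_norm f.
Proof. by apply: ub_le_sup; [exact: C0_has_ubound|exists x]. Qed.

Lemma sup_norm_le (f : C0) (M : R) :
  0 <= M -> (forall x, `|f x| <= M) -> sup_norm f <= M.
Proof.
move=> M0 fM; rewrite /sup_norm.
have [->|/set0P ne] := eqVneq [set `|f x| | x in [set: L]] set0.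
  by rewrite sup0.
by apply: ge_sup => // _ [x _ <-].
Qed.

Lemma sup_norm_ge0 (f : C0) : 0 <= sup_norm f.
Proof.
have [e|/set0P[_ [x _ _]]] := eqVneq [set `|f x| | x in [set: L]] set0.
  by rewrite /sup_norm e sup0.
exact: le_trans (sup_norm_ge f x).
Qed.

Lemma sup_normD (f g : C0) : sup_norm (f + g) <= sup_norm f + sup_norm g.
Proof.
apply: sup_norm_le; first by rewrite addr_ge0 ?sup_norm_ge0.
by move=> x; apply: (le_trans (ler_normD _ _)); rewrite lerD ?sup_norm_ge.
Qed.

Lemma sup_normZ (a : R) (f : C0) : sup_norm (a *: f) = `|a| * sup_norm f.
Proof.
have leZ b (g : C0) : sup_norm (b *: g) <= `|b| * sup_norm g.
  apply: sup_norm_le; first by rewrite mulr_ge0 ?sup_norm_ge0.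
  by move=> x; rewrite [leLHS]normrZ ler_wpM2l ?sup_norm_ge.
apply/eqP; rewrite eq_le leZ/=.
have [->|a0] := eqVneq a 0; first by rewrite normr0 mul0r sup_norm_ge0.
rewrite -ler_pdivlMl ?normr_gt0// -normfV.
by rewrite -[in leLHS](scalerK a0 f); exact: leZ.
Qed.

Lemma sup_norm0_eq0 (f : C0) : sup_norm f = 0 -> f = 0.
Proof.
move=> f0; apply/val_inj/funext => x.
by apply/normr0_eq0/eqP; rewrite eq_le normr_ge0 -f0 sup_norm_ge.
Qed.

HB.instance Definition _ :=
  Lmodule_isNormed.Build R C0 sup_normD sup_normZ sup_norm0_eq0.

End C0_def.

Section dual_def.
Variables (R : realType) (X : normedModType R).

Definition dual_pred : {pred X -> R^o} :=
  mem [set f : X -> R^o | linear f /\ continuous f].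

Record dual := MkDual {
  dual_val :> X -> R^o;
  dual_valP : dual_val \in dual_pred }.

HB.instance Definition _ := [isSub for dual_val].
HB.instance Definition _ := [Choice of dual by <:].

Lemma dual_linear (f : dual) : linear f.
Proof. by case: f => f /= /set_mem[]. Qed.

Lemma dual_continuous (f : dual) : continuous f.
Proof. by case: f => f /= /set_mem[]. Qed.

HB.instance Definition _ (f : dual) :=
  GRing.isLinear.Build R X R^o *:%R (dual_val f) (dual_linear f).

Lemma dual_submod_closed : submod_closed dual_pred.
Proof.
split.
  apply/mem_set; split; last by move=> x; exact: cvg_cst.
  by move=> a u v /=; rewrite scaler0 addr0.
move=> a f g /set_mem[lf cf] /set_mem[lg cg]; apply/mem_set; split.
  move=> b u v.
  rewrite -[(a *: f + g) _]/(a *: f (b *: u + v) + g (b *: u + v)) lf lg.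
  rewrite -[X in _ = X]/(b *: (a *: f u + g u) + (a *: f v + g v)).
  by rewrite !scalerDr !scalerA [a * b]mulrC addrACA.
by move=> x; apply: cvgD; [apply: cvgZl_tmp; exact: cf|exact: cg].
Qed.

HB.instance Definition _ := GRing.isSubmodClosed.Build _ _ dual_pred
  dual_submod_closed.
HB.instance Definition _ := [SubChoice_isSubLmodule of dual by <:].

Definition op_norm (f : dual) : R := sup [set `|f x| | x in [set x | `|x| <= 1]].

Lemma dual_has_sup (f : dual) : has_sup [set `|f x| | x in [set x | `|x| <= 1]].
Proof.
split; first by exists `|f 0|, 0 => //=; rewrite normr0.
have /linear_bounded_continuous/linear_boundedP/pinfty_ex_gt0[r r0 fr] :=
  @dual_continuous f.
exists r => _ [x /= x1 <-]; apply: (le_trans (fr x)).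
by rewrite ler_piMr// ltW.
Qed.

Lemma op_norm_ge1 (f : dual) x : `|x| <= 1 -> `|f x| <= op_norm f.
Proof. by move=> x1; apply: ub_le_sup; [case: (dual_has_sup f)|exists x]. Qed.

Lemma op_norm_le (f : dual) (M : R) :
  (forall x, `|x| <= 1 -> `|f x| <= M) -> op_norm f <= M.
Proof.
move=> fM; apply: ge_sup; first by case: (dual_has_sup f).
by move=> _ [x /= x1 <-]; exact: fM.
Qed.

Lemma op_norm_ge0 (f : dual) : 0 <= op_norm f.
Proof. by apply: le_trans (op_norm_ge1 f (x := 0) _); rewrite ?normr0. Qed.

Lemma op_norm_ge (f : dual) x : `|f x| <= op_norm f * `|x|.
Proof.
have [->|x0] := eqVneq x 0; first by rewrite linear0 !normr0 mulr0.
rewrite -ler_pdivrMr ?normr_gt0// mulrC.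
have <- : `|f (`|x|^-1 *: x)| = `|x|^-1 * `|f x|.
  by rewrite linearZ/= normrZ normfV normr_id.
by apply: op_norm_ge1; rewrite normrZ normfV normr_id mulVf ?normr_eq0.
Qed.

Lemma op_normD (f g : dual) : op_norm (f + g) <= op_norm f + op_norm g.
Proof.
apply: op_norm_le => x x1; apply: (le_trans (ler_normD _ _)).
by rewrite lerD ?op_norm_ge1.
Qed.

Lemma op_normZ (a : R) (f : dual) : op_norm (a *: f) = `|a| * op_norm f.
Proof.
have leZ b (g : dual) : op_norm (b *: g) <= `|b| * op_norm g.
  by apply: op_norm_le => x x1; rewrite [leLHS]normrZ ler_wpM2l ?op_norm_ge1.
apply/eqP; rewrite eq_le leZ/=.
have [->|a0] := eqVneq a 0; first by rewrite normr0 mul0r op_norm_ge0.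
rewrite -ler_pdivlMl ?normr_gt0// -normfV.
by rewrite -[in leLHS](scalerK a0 f); exact: leZ.
Qed.

Lemma op_norm0_eq0 (f : dual) : op_norm f = 0 -> f = 0.
Proof.
move=> f0; apply/val_inj/funext => x.
apply/normr0_eq0/eqP; rewrite eq_le normr_ge0 andbT.
by apply: (le_trans (op_norm_ge f x)); rewrite f0 mul0r.
Qed.

HB.instance Definition _ :=
  Lmodule_isNormed.Build R dual op_normD op_normZ op_norm0_eq0.

End dual_def.

(** [weak V] and [weak_star X] are copies of the types [V] and [dual X], which
    themselves carry the norm topology. *)
Definition weak (R : realType) (V : normedModType R) : topologicalType :=
  sup_topology (fun phi : dual V =>
    Topological.on (initial_topology (phi : V -> R^o))).

Definition weak_star (R : realType) (X : normedModType R) : topologicalType :=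
  sup_topology (fun x : X =>
    Topological.on (initial_topology (fun phi : dual X => phi x))).

Definition unit_ball (R : realType) (V : normedModType R) : set V :=
  [set v | `|v| <= 1].

Definition extreme_points (R : realType) (V : lmodType R) (A : set V) : set V :=
  [set v | A v /\ forall (y z : V) (t : R), A y -> A z -> 0 < t < 1 ->
    v = t *: y + (1 - t) *: z -> y = v /\ z = v].

(** The type casts select the ambient topology inherited by the subtype; the
    underlying types are convertible, so that [ball_id] is the identity. *)
Definition ball_weak_star (R : realType) (X : normedModType R) :
    topologicalType :=
  set_type (@unit_ball R (dual X) : set (weak_star X)).

Definition ball_weak (R : realType) (X : normedModType R) : topologicalType :=
  set_type (@unit_ball R (dual X) : set (weak (dual X))).

Definition ball_id (R : realType) (X : normedModType R) :
  ball_weak_star X -> ball_weak X := fun phi => phi.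

Definition discrete_space (L : topologicalType) := forall A : set L, open A.

(* Main.v *)
Require Import Defs.
From HB Require Import structures.
From mathcomp Require Import all_boot all_order all_algebra.
From mathcomp Require Import all_classical all_reals all_analysis.
From mathcomp Require Import finmap lra.

(** If [L] is discrete, [C0 R L] behaves like c_0, its dual like l^1, and an
    extreme point [phi] of the dual ball satisfies [|phi 1_x| = 1] for some [x]
    (or the dual is trivial). Since [|psi 1_x| + |psi f| <= 1] whenever [f] in
    the unit ball vanishes at [x], such a [phi] has
    [|psi - phi| <= 2 |psi 1_x - phi 1_x|] on the dual ball: weak-*
    convergence to [phi] there is norm convergence.

    Conversely, evaluation at [x] is extreme, and the functional
    [mu |-> mu {x}] on the dual separates it from every other evaluation; as
    [y |-> evaluation y] is weak-* continuous, continuity of the identity at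
    [evaluation x] makes [x] isolated. To avoid representing the dual by
    measures, [mu {x}] is obtained as an ultrafilter limit of [mu g] along
    bumps [g] shrinking to [x]. *)

Set Implicit Arguments.
Unset Strict Implicit.
Unset Printing Implicit Defensive.

Import Order.TTheory GRing.Theory Num.Theory.
Import numFieldNormedType.Exports.

Local Open Scope classical_set_scope.
Local Open Scope ring_scope.

(** * Convergence in initial, weak and weak-* topologies *)

Lemma cvg_initial (S : choiceType) (T : topologicalType) (f : S -> T)
    (F : set_system S) (s : S) :
  Filter F -> f @ F --> f s -> F --> (s : initial_topology f).
Proof.
move=> FF fF A [_ [[B oB <-] Bfs] BA].
by rewrite nbhs_filterE; apply: filterS BA _; apply: fF; exact: open_nbhs_nbhs.
Qed.

Section weak_topologies.
Variables (R : realType) (V : normedModType R).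

Lemma weak_cvgP (F : set_system V) (v : V) : Filter F ->
  F --> (v : weak V) <-> forall Phi : dual V, Phi @ F --> Phi v.
Proof.
move=> FF; split=> [/cvg_sup Fv Phi|Fv].
  apply: (@cvg_trans _ (Phi @ nbhs (v : initial_topology (Phi : V -> R^o)))).
    exact: cvg_app (Fv Phi).
  exact: (@initial_continuous _ _ (Phi : V -> R^o)).
by apply/cvg_sup => Phi; exact: cvg_initial.
Qed.

Lemma weak_star_cvgP (F : set_system (dual V)) (phi : dual V) : Filter F ->
  F --> (phi : weak_star V) <->
  forall x : V, (fun psi : dual V => psi x) @ F --> phi x.
Proof.
move=> FF; split=> [/cvg_sup Fv x|Fv].
  pose ev := fun psi : dual V => psi x.
  apply: (@cvg_trans _ (ev @ nbhs (phi : initial_topology ev))).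
    exact: cvg_app (Fv x).
  exact: (@initial_continuous _ _ ev).
by apply/cvg_sup => x; apply: cvg_initial; exact: Fv.
Qed.

Lemma bounded_linear_dual_pred (f : V -> R^o) (M : R) :
  linear f -> (forall v, `|f v| <= M * `|v|) -> f \in @dual_pred R V.
Proof.
move=> lf fM; apply/mem_set; split => //.
pose fL := GRing.isLinear.Build R V R^o *:%R f lf.
pose g : {linear V -> R^o} := HB.pack f fL.
apply/(@linear_bounded_continuous _ _ _ g)/linear_boundedP.
near=> r => v; apply: (le_trans (fM v)); rewrite ler_wpM2r//.
Unshelve. all: end_near. Qed.

Lemma unit_ball_dualP (phi : dual V) :
  unit_ball phi <-> forall v, `|phi v| <= `|v|.
Proof.
split=> [phi1 v|phi1].
  by apply: (le_trans (op_norm_ge phi v)); rewrite ler_piMl.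
by apply: op_norm_le => v v1; exact: le_trans (phi1 v) v1.
Qed.

End weak_topologies.

(** * Bidual functionals as ultrafilter limits *)

Section ultrafilter_functional.
Variables (R : realType) (V : normedModType R) (U : set_system V).
Hypotheses (UU : UltraFilter U) (U1 : U (@unit_ball R V)).

(** The image ultrafilter contains a compact segment, so it has a cluster point, and an ultrafilter
    converges to each of its cluster points. *)
Lemma ultra_dual_cvg (phi : dual V) :
  exists l : R^o, (phi : V -> R^o) @ U --> l.
Proof.
have PU := ultra_proper (F := U).
have phiU : (phi @ U) `[- op_norm phi, op_norm phi]%classic.
  have sub : @unit_ball R V `<=` phi @^-1` `[- op_norm phi, op_norm phi].
    by move=> v v1 /=; rewrite in_itv /= -ler_norml; exact: op_norm_ge1.
  exact: filterS sub U1.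
have [l [_ lU]] := @segment_compact _ _ _ (phi @ U) _ phiU.
exists l => A Al; have [//|UA] := in_ultra_setVsetC (phi @^-1` A) UU.
by have [y [/=]] := lU (~` A) A UA Al.
Qed.

(** Pointwise limits along [U] inherit linearity, and the bound [|f v| <= |f|] on the unit ball, a
    member of [U], passes to the limit. *)
Lemma ultra_bidual : exists Phi : dual (dual V),
  forall phi : dual V, (phi : V -> R^o) @ U --> (Phi phi : R^o).
Proof.
have PU := ultra_proper (F := U).
have [F FE] := choice ultra_dual_cvg.
have uniq_lim := @cvg_unique R^o (@norm_hausdorff _ _).
have linF : linear F.
  move=> a f g; apply: (uniq_lim ((a *: f + g : V -> R^o) @ U)).
    exact: FE.
  by apply: cvgD; [apply: cvgZl_tmp|]; exact: FE.
have F_le f : `|F f| <= 1 * `|f|.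
  rewrite mul1r; apply: (@closed_cvg _ _ _ _ _ (fun y : R^o => `|y| <= `|f|)
    _ _ (F f) (FE f)).
    apply: (@preimage_closed _ _ (fun y : R^o => `|y|) [set y | y <= `|f|]).
      by move=> y _; exact: norm_continuous.
    exact: closed_le.
  have sub : @unit_ball R V `<=` [set v | `|f v| <= `|f|].
    by move=> v; exact: op_norm_ge1.
  exact: filterS sub U1.
by exists (MkDual (bounded_linear_dual_pred linF F_le)).
Qed.

End ultrafilter_functional.

(** * Evaluations, bumps and point masses *)

Section evaluation.
Variables (R : realType) (L : topologicalType).
Local Notation C0 := (C0 R L).

Lemma C0_addE (f g : C0) x : (f + g) x = f x + g x. Proof. by []. Qed.
Lemma C0_oppE (f : C0) x : (- f) x = - f x. Proof. by []. Qed.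
Lemma C0_scaleE (a : R) (f : C0) x : (a *: f) x = a * f x. Proof. by []. Qed.
Definition C0E := (C0_addE, C0_oppE, C0_scaleE).

Lemma C0_norm_ge (f : C0) x : `|f x| <= `|f|.
Proof. exact: sup_norm_ge. Qed.

Lemma C0_norm_le (f : C0) (M : R) :
  0 <= M -> (forall x, `|f x| <= M) -> `|f| <= M.
Proof. exact: sup_norm_le. Qed.

Fact evaluation_subproof x : (fun f : C0 => f x : R^o) \in @dual_pred R C0.
Proof.
apply: (@bounded_linear_dual_pred _ _ _ 1) => // f.
by rewrite mul1r; exact: C0_norm_ge.
Qed.

Definition evaluation x : dual C0 := MkDual (evaluation_subproof x).

Lemma evaluation_unit_ball x : unit_ball (evaluation x).
Proof. by apply/unit_ball_dualP => f; exact: C0_norm_ge. Qed.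

Definition evaluation_ball x : ball_weak_star C0 :=
  exist _ (evaluation x) (mem_set (evaluation_unit_ball x)).

Lemma evaluation_ball_continuous : continuous evaluation_ball.
Proof.
move=> x; apply: cvg_initial; apply/weak_star_cvgP => f.
exact: C0_continuous.
Qed.

Hypotheses (Lhausdorff : hausdorff_space L)
  (Lcompact : locally_compact [set: L]).

Lemma C0_bump x (N : set L) : nbhs x N ->
  exists g : C0, [/\ g x = 1, forall y, 0 <= g y <= 1
    & forall y, ~ N y -> g y = 0].
Proof.
move=> Nx; have [K Kx [cK clK]] := Lcompact (x := x) I.
have {}Kx : nbhs x K by rewrite withinET in Kx.
(* Complete regularity gives [f] equal to 0 at [x] and 1 on [B]. Then [1 - f] lives inside the
   compact [K], which makes it vanish at infinity. *)
pose B := ~` (K `&` N)°.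
have nBx : ~ B x by rewrite /B /= => /(_ _); apply; exact: filterI.
have clB : closed B by apply/open_closedC/open_interior.
have /(@uniform_separatorP _ R)[f [cf f01 fx fB]] :=
  @locally_compact_completely_regular _ R Lcompact Lhausdorff x B clB nBx.
have {}f01 y : 0 <= f y <= 1.
  by have := f01 (f y) (ex_intro2 _ _ y I erefl); rewrite /= in_itv.
have {}fB y : ~ (K `&` N) y -> f y = 1.
  move=> KNy; apply: fB; exists y => //.
  by apply: contra_not KNy; exact: interior_subset.
pose g : L -> R^o := fun y => 1 - f y.
have cg : continuous g by move=> y; apply: cvgB; [exact: cvg_cst|exact: cf].
have vg : vanishes_at_infinity g.
  move=> e e0; apply: (subclosed_compact _ cK); first exact: closed_norm_ge.
  move=> y /= ey; apply: contrapT => Ky; move: ey; apply/negP.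
  by rewrite -ltNge /g fB ?subrr ?normr0// => -[].
exists (MkC0 (mem_set (conj cg vg))); split => [|y|y Ny] /=; rewrite /g.
- by rewrite (fx (f x)) ?subr0//; exists x.
- by have /andP[f0 f1] := f01 y; rewrite subr_ge0 f1 gerBl.
- by rewrite fB ?subrr// => -[].
Qed.

(* If [h x = 0], a bump [g] at [x] supported where [|h| < e] satisfies
   [|g + s c h| <= 1 + c e] for [s = 1, -1] and [c = 1 / (|h| + 1)]; as
   [mu g = 1], this forces [|mu h| <= e]. *)
Lemma evaluation_extreme_left x (mu nu : dual C0) (t : R) :
  unit_ball mu -> unit_ball nu -> 0 < t < 1 ->
  evaluation x = t *: mu + (1 - t) *: nu -> mu = evaluation x.
Proof.
move=> /unit_ball_dualP mu1 /unit_ball_dualP nu1 /andP[t0 t1] xE.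
have mu_bump (g : C0) : g x = 1 -> (forall y, 0 <= g y <= 1) -> mu g = 1.
  move=> gx g01.
  have g1 : `|g| <= 1.
    by apply: C0_norm_le => // y; have /andP[g0 ?] := g01 y; rewrite ger0_norm.
  have mug : mu g <= 1.
    exact: le_trans (ler_norm _) (le_trans (mu1 g) g1).
  have nug : nu g <= 1.
    exact: le_trans (ler_norm _) (le_trans (nu1 g) g1).
  (* The value 1 is a proper convex combination of two numbers at most 1, so neither can be
     smaller. *)
  have : g x = t * mu g + (1 - t) * nu g.
    by have := congr1 (fun phi : dual C0 => phi g) xE.
  rewrite gx => E; apply/eqP; rewrite eq_le mug /= leNgt; apply/negP => mug1.
  nra.
have [g0 [g0x g001 _]] := C0_bump (N := setT) (x := x) filterT.
have mu_x0 (h : C0) : h x = 0 -> mu h = 0.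
  move=> hx; apply/eqP; rewrite -normr_le0; apply/ler_addgt0Pl => e e0.
  rewrite addr0.
  pose c := (`|h| + 1)^-1.
  have c0 : 0 < c by rewrite invr_gt0 ltr_wpDl.
  have ch y : c * `|h y| <= 1.
    rewrite ler_pdivrMl ?ltr_wpDl// mulr1 (le_trans (C0_norm_ge h y))//.
    by rewrite lerDl.
  have Nx : nbhs x [set y | `|h y| < e].
    have /cvgr_norm_lt := C0_continuous (f := h) (x := x).
    by apply; rewrite hx normr0.
  have [g [gx g01 gN]] := C0_bump Nx.
  have key (s : R) : `|s| = 1 -> s * mu h <= e.
    move=> s1; have gch : `|g + (s * c) *: h| <= 1 + c * e.
      have ce0 : 0 <= c * e by rewrite mulr_ge0// ltW.
      apply: C0_norm_le => [|y]; first by rewrite addr_ge0.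
      rewrite !C0E; have /andP[gy0 gy1] := g01 y.
      apply: (le_trans (ler_normD _ _)).
      rewrite ger0_norm// !normrM s1 mul1r gtr0_norm//.
      have [hy|/negP hy] := boolP (`|h y| < e).
        by rewrite lerD// ler_pM2l// ltW.
      by rewrite gN// add0r (le_trans (ch y))// lerDl.
    have := le_trans (ler_norm _) (le_trans (mu1 _) gch).
    rewrite linearD linearZ /= mu_bump// lerD2l.
    by rewrite /GRing.scale /= mulrAC [leLHS]mulrC ler_pM2l.
  have := key 1 (normr1 _); have := key (-1) (normrN1 _).
  rewrite mul1r mulN1r => mh1 mh2; rewrite ler_norml mh2.
  by rewrite lerNl mh1.
apply/val_inj/funext => f; rewrite -[LHS]/(mu f) /=.
(* Subtracting [f x *: g0] produces a function vanishing at [x], and [mu g0 = 1]. *)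
have := mu_x0 (f - f x *: g0); rewrite !C0E g0x mulr1 subrr => /(_ erefl).
rewrite linearB linearZ /= (mu_bump g0)// => /subr0_eq ->; exact: mulr1.
Qed.

Lemma evaluation_extreme x :
  extreme_points (@unit_ball R (dual C0)) (evaluation x).
Proof.
split=> [|mu nu t mu1 nu1 /andP[t0 t1] xE]; first exact: evaluation_unit_ball.
split; first by apply: (evaluation_extreme_left mu1 nu1 _ xE); rewrite t0.
apply: (@evaluation_extreme_left _ _ mu (1 - t)) => //.
  by rewrite subr_gt0 t1 gtrBl.
by rewrite xE subKr addrC.
Qed.

Lemma point_mass_functional x : exists Phi : dual (dual C0),
  Phi (evaluation x) = 1 /\ forall y, y <> x -> Phi (evaluation y) = 0.
Proof.
pose bumps (N : set L) := [set g : C0 | [/\ g x = 1, `|g| <= 1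
  & forall y, ~ N y -> g y = 0]].
(* The sets [bumps N] shrink with [N], and [C0_bump] makes each of them nonempty. *)
have bumpsF : ProperFilter (filter_from (nbhs x) bumps).
  apply: filter_from_proper.
    apply: filter_from_filter; first by exists setT; exact: filterT.
    move=> M N Mx Nx; exists (M `&` N); first exact: filterI.
    by move=> g [gx g1 gMN]; split; split => // y ny; apply: gMN => -[].
  move=> N /C0_bump[g [gx g01 gN]]; exists g; split => //.
  apply: C0_norm_le => // y; have /andP[g0 g1] := g01 y.
  by rewrite ger0_norm.
have [U [UU bumpsU]] := ultraFilterLemma bumpsF.
have U1 : U (@unit_ball R C0).
  by apply: bumpsU; exists setT; [exact: filterT|move=> g []].
have [Phi PhiE] := ultra_bidual UU U1.
have PU := ultra_proper (F := U).
have PhiU (phi : dual C0) (c : R^o) : U [set g | phi g = c] -> Phi phi = c.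
  move=> Uc; apply: (@cvg_unique R^o (@norm_hausdorff _ _) (phi @ U)).
    exact: PhiE.
  by apply: cvg_near_cst.
exists Phi; split=> [|y yx].
  by apply: PhiU; apply: bumpsU; exists setT; [exact: filterT|move=> g []].
(* Points are closed, so this is a neighbourhood of [x]; every bump supported in it vanishes at
   [y]. *)
apply: PhiU; apply: bumpsU; exists (~` [set y]).
  apply: open_nbhs_nbhs; split; last by move=> /esym.
  apply: closed_openC.
  exact: accessible_closed_set1 (hausdorff_accessible Lhausdorff) y.
by move=> g [_ _ gN]; apply: gN => /(_ erefl).
Qed.

End evaluation.

Lemma continuous_ball_id_discrete (R : realType) (L : topologicalType) :
  hausdorff_space L -> locally_compact [set: L] ->
  (forall phi : ball_weak_star (C0 R L),
     extreme_points (@unit_ball R (dual (C0 R L))) (set_val phi) ->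
     {for phi, continuous (@ball_id R (C0 R L))}) ->
  discrete_space L.
Proof.
move=> hL lL cid.
have nbhs1 (x : L) : nbhs x [set x].
  have [Phi [Phix Phiy]] := @point_mass_functional R _ hL lL x.
  have cx := cid (evaluation_ball R x) (evaluation_extreme R hL lL x).
  have cPhi : (Phi (evaluation R y) : R^o) @[y --> x] --> (1 : R^o).
    rewrite -Phix.
    have cev : evaluation R y @[y --> x] --> (evaluation R x : weak _).
      apply: (@cvg_comp _ _ _ (@ball_id R (C0 R L) \o @evaluation_ball R L)
        set_val _ (nbhs (ball_id (evaluation_ball R x)))).
        exact: (cvg_comp _ _ (@evaluation_ball_continuous R L x) cx).
      exact: (@initial_continuous (ball_weak (C0 R L)) (weak (dual (C0 R L)))
        set_val (ball_id (evaluation_ball R x))).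
    by have /weak_cvgP := cev; apply.
  (* The function [y |-> Phi (evaluation y)] is the indicator of [x]; its continuity at [x] makes
     [[set x]] a neighbourhood. *)
  have pos1 (y : L) : 0 < Phi (evaluation R y) -> y = x.
    by move=> y0; apply: contrapT => /Phiy yx; rewrite yx ltxx in y0.
  exact: filterS pos1 (cvgr_gt (1 : R^o) cPhi 0 ltr01).
move=> A; rewrite openE => x Ax; apply: filterS (nbhs1 x) => y ->; exact: Ax.
Qed.

(** * The discrete case *)

Lemma compact_discrete_finite (T : topologicalType) (K : set T) :
  discrete_space T -> compact K -> finite_set K.
Proof.
move=> dT cK; apply: contrapT => infK.
(* The sets containing all but finitely many points of [K]: a proper filter when [K] is infinite. It
   clusters at no [p], since it contains the complement of the neighbourhood [[set p]]. *)
pose F := [set B : set T | finite_set (K `\` B)].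
have FF : ProperFilter F.
  split; first by rewrite /F /= setD0.
  split; first by rewrite /F /= setDT.
    by move=> A B; rewrite /F /= setDIr finite_setU.
  by move=> A B AB; apply: sub_finite_set; exact: setDS.
have FK : F K by rewrite /F /= setDv.
have [p [_ clp]] := cK F FF FK.
have Fp : F (~` [set p]).
  by rewrite /F /= setDE setCK; apply: finite_setIr; exact: finite_set1.
have np : nbhs p [set p] by apply: open_nbhs_nbhs; split => //; exact: dT.
by have [y [/=]] := clp _ _ Fp np.
Qed.

Section discrete.
Variables (R : realType) (L : topologicalType).
Hypothesis dL : discrete_space L.
Local Notation C0 := (C0 R L).

Fact C0_indic_subproof x :
  (fun y => (y == x)%:R : R^o) \in @C0_pred R L.
Proof.
apply/mem_set; split.
  by apply/continuousP => A _; exact: dL.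
move=> e e0; apply: finite_compact; apply: (@sub_finite_set _ _ [set x]).
  move=> y /=; have [//|_] := eqVneq y x.
  by rewrite normr0 leNgt e0.
exact: finite_set1.
Qed.

Definition C0_indic x : C0 := MkC0 (C0_indic_subproof x).

Lemma C0_indicE x y : C0_indic x y = (y == x)%:R. Proof. by []. Qed.

(** Level sets are compact, hence finite, so truncating [f] to one approximates it uniformly by a
    finite combination of indicators. *)
Lemma dual_ext_indic (phi : dual C0) :
  (forall x, phi (C0_indic x) = 0) -> phi = 0.
Proof.
move=> phi0; apply/val_inj/funext => f; rewrite -[LHS]/(phi f) -[RHS]/(0 : R).
apply/eqP; rewrite -normr_le0; apply/ler_addgt0Pl => e e0; rewrite addr0.
(* Chosen so that [|phi| * (e * c) <= e]; the added 1 covers [phi = 0]. *)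
pose c := (`|phi| + 1)^-1.
have c0 : 0 < c by rewrite invr_gt0 ltr_wpDl.
have K := compact_discrete_finite dL (C0_vanishes (f := f) (mulr_gt0 e0 c0)).
pose g : C0 := \sum_(x <- fset_set [set x | e * c <= `|f x|]) f x *: C0_indic x.
have gE y : g y = if e * c <= `|f y| then f y else 0.
  have -> : g y = \sum_(x <- fset_set [set x | e * c <= `|f x|])
      f x * (y == x)%:R by rewrite -[LHS]/(evaluation R y g) linear_sum.
  case: ifPn => fy.
    rewrite (bigD1_seq y) ?fset_uniq//=; last first.
      by rewrite in_fset_set//; apply: mem_set.
    rewrite eqxx mulr1 big1 ?addr0// => x /negPf xy.
    by rewrite eq_sym xy mulr0.
  rewrite big1_seq// => x /=; rewrite in_fset_set// => /set_mem /= fx.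
  by have [yx|] := eqVneq y x; [rewrite yx fx in fy|rewrite mulr0].
have phig : phi g = 0.
  by rewrite linear_sum big1_seq// => x _; rewrite linearZ /= phi0 scaler0.
have fg : `|f - g| <= e * c.
  apply: C0_norm_le => [|y]; first by rewrite mulr_ge0// ltW.
  rewrite !C0E gE; case: ifPn => [_|]; last by rewrite subr0 -ltNge => /ltW.
  by rewrite subrr normr0 mulr_ge0// ltW.
have -> : phi f = phi (f - g) by rewrite linearB /= phig subr0.
apply: (le_trans (op_norm_ge phi _)).
apply: (le_trans (ler_wpM2l (op_norm_ge0 _) fg)).
have pc1 : `|phi| * c <= 1 by rewrite ler_pdivrMr ?ltr_wpDl// mul1r lerDl.
by rewrite mulrCA ler_piMr //; apply: ltW.
Qed.

(** The indicator and [h] have disjoint supports, so [s *: C0_indic x + r *: h] stays in the unit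
    ball for [|s|, |r| <= 1]. Taking for [s] and [r] the signs of the two values of [psi] gives the
    sum of absolute values. *)
Lemma dual_indic_split (psi : dual C0) (x : L) (f : C0) :
  unit_ball psi -> `|f| <= 1 ->
  `|psi (C0_indic x)| + `|psi (f - f x *: C0_indic x)| <= 1.
Proof.
move=> /unit_ball_dualP psi1 f1.
set h := f - _.
have key (s r : R) : `|s| <= 1 -> `|r| <= 1 ->
    s * psi (C0_indic x) + r * psi h <= 1.
  move=> s1 r1; have : `|s *: C0_indic x + r *: h| <= 1.
    apply: C0_norm_le => // y; rewrite !C0E C0_indicE.
    have [->|_] := eqVneq y x.
      by rewrite !mulr1 subrr mulr0 addr0.
    rewrite !mulr0 add0r subr0 normrM.
    by rewrite mulr_ile1// (le_trans (C0_norm_ge f y)).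
  move=> /(le_trans (psi1 _)) /(le_trans (ler_norm _)).
  by rewrite linearD !linearZ.
rewrite !normrEsg; apply: key; rewrite normr_sg;
  by [exact: lern1 | case: (_ != _)].
Qed.

(** By [dual_indic_split], [phi] kills the part [h] of [f] off [x], while [|psi h|] is at most
    [1 - |psi 1_x|], hence at most [|psi 1_x - phi 1_x|]. The part at [x] contributes the same bound
    once more. *)
Lemma dual_indic_dist (phi psi : dual C0) (x : L) :
  unit_ball phi -> unit_ball psi -> `|phi (C0_indic x)| = 1 ->
  `|psi - phi| <= 2 * `|psi (C0_indic x) - phi (C0_indic x)|.
Proof.
move=> phi1 psi1 phix; apply: op_norm_le => f f1.
rewrite -[(psi - phi) f]/(psi f - phi f).
have phis := dual_indic_split x phi1 f1.
have psis := dual_indic_split x psi1 f1.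
set h := f - f x *: C0_indic x in phis psis.
have fE : f = f x *: C0_indic x + h by rewrite addrC subrK.
rewrite phix gerDl normr_le0 in phis.
clearbody h.
have evalE (chi : dual C0) : chi f = f x * chi (C0_indic x) + chi h.
  by rewrite {1}fE linearD linearZ.
rewrite !evalE (eqP phis) addr0 addrAC -mulrBr (le_trans (ler_normD _ _))//.
rewrite mulrDl mul1r lerD//.
  by rewrite normrM ler_piMl// (le_trans (C0_norm_ge f x)).
rewrite -lerBrDl in psis; apply: (le_trans psis); rewrite -phix distrC.
exact: lerB_dist.
Qed.

(** If [t = |phi 1_x|] were strictly between 0 and 1, splitting off the mass of [phi] at [x] would
    write it as a convex combination of a signed evaluation [y] and the normalized remainder [z].
    Extremality would give [y = phi], yet [|y 1_x| = 1]. *)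
Lemma extreme_indic (phi : dual C0) : extreme_points (@unit_ball R _) phi ->
  phi <> 0 -> exists x, `|phi (C0_indic x)| = 1.
Proof.
move=> [phi1 phiX] phi0.
have [x phix0] : exists x, phi (C0_indic x) != 0.
  apply: contrapT => /forallNP phix; apply/phi0/dual_ext_indic => x.
  by have /negP := phix x; rewrite negbK => /eqP.
exists x; set t := `|phi (C0_indic x)|.
have t0 : 0 < t by rewrite normr_gt0.
have ind1 : `|C0_indic x| <= 1.
  apply: C0_norm_le => // y; rewrite C0_indicE.
  by case: (y == x); rewrite ?normr1 ?normr0.
have tle1 : t <= 1.
  by have /unit_ball_dualP/(_ _)/le_trans := phi1; apply.
apply/eqP; rewrite eq_le tle1 leNgt /=; apply/negP => t1.
pose c := phi (C0_indic x).
pose y : dual C0 := (c / t) *: evaluation R x.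
pose z : dual C0 := (1 - t)^-1 *: (phi - c *: evaluation R x).
have y1 : unit_ball y.
  rewrite /unit_ball /= normrZ normrM normfV (ger0_norm (ltW t0)) -/t.
  by rewrite divff ?gt_eqF// mul1r; exact: evaluation_unit_ball.
(* [dual_indic_split] leaves at most [1 - t] for the remainder, exactly what the factor [(1 - t)^-1]
   compensates. *)
have z1 : unit_ball z.
  apply: op_norm_le => f f1.
  have := dual_indic_split x phi1 f1; rewrite -/t -lerBrDl.
  rewrite linearB linearZ /= => phif.
  change (`|(1 - t)^-1 * (phi f - c * f x)| <= 1); rewrite normrM.
  rewrite gtr0_norm ?invr_gt0 ?subr_gt0// ler_pdivrMl ?subr_gt0// mulr1.
  by rewrite [c * _]mulrC.
have phiE : phi = t *: y + (1 - t) *: z.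
  rewrite !scalerA mulrCA divff ?gt_eqF// mulr1 divff ?scale1r.
    by rewrite addrC subrK.
  by rewrite gt_eqF// subr_gt0.
have [yphi _] := phiX y z t y1 z1 (introT andP (conj t0 t1)) phiE.
have : `|y (C0_indic x)| = t by rewrite yphi.
rewrite -[y _]/(c / t * (x == x)%:R) eqxx mulr1 normrM normfV normr_id -/t.
by rewrite divff ?gt_eqF// => t1'; rewrite -t1' ltxx in t1.
Qed.

Lemma discrete_continuous_ball_id (phi : ball_weak_star C0) :
  extreme_points (@unit_ball R (dual C0)) (set_val phi) ->
  {for phi, continuous (@ball_id R C0)}.
Proof.
move=> phiX; have phi1 : unit_ball (set_val phi : dual C0) := phiX.1.
pose val_dual (psi : ball_weak_star C0) : dual C0 := set_val psi.
have val1 psi : unit_ball (val_dual psi) by exact: set_valP.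
suff W : val_dual @ phi --> (val_dual phi : weak (dual C0)).
  apply: (@cvg_initial (ball_weak C0) (weak (dual C0)) set_val); last exact: W.
  by apply: fmap_filter; exact: nbhs_filter.
have FF : Filter (val_dual @ phi) by apply: fmap_filter; exact: nbhs_filter.
have [_] := @weak_cvgP R (dual C0) _ (val_dual phi) FF; apply => Phi.
suff cPhi : Phi (val_dual psi) @[psi --> phi] --> (Phi (val_dual phi) : R^o).
  exact: cPhi.
have [phi0|phi0] := pselect (val_dual phi = 0).
  (* As 0 is the midpoint of [psi] and [- psi], its extremality collapses the ball to one point. *)
  have ball0 (psi : dual C0) : unit_ball psi -> psi = 0.
    move=> psi1; have psiN1 : unit_ball (- psi) by rewrite /unit_ball /= normrN.
    have half : 0 < (2^-1 : R) < 1 by lra.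
    have midpoint : val_dual phi = 2^-1 *: psi + (1 - 2^-1) *: - psi.
      rewrite phi0 scalerN -scalerBl (_ : _ - _ = 0) ?scale0r//.
      by lra.
    by have [->] := phiX.2 _ _ _ psi1 psiN1 half midpoint.
  apply: (@cvg_near_cst _ R^o _ _ (nbhs phi) (nbhs_filter phi)).
  apply: (@filterE _ _ (nbhs_filter phi)) => psi.
  by rewrite (ball0 _ (val1 psi)) (ball0 _ (val1 phi)).
have [x phix] := extreme_indic phiX phi0.
have cx : val_dual psi (C0_indic x) @[psi --> phi] -->
    val_dual phi (C0_indic x).
  have : val_dual @ phi --> (val_dual phi : weak_star C0).
    exact: (@initial_continuous (ball_weak_star C0) (weak_star C0) set_val phi).
  by move=> /weak_star_cvgP; apply.
have phiF : Filter (nbhs phi) := nbhs_filter phi.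
apply/cvgrPdist_le => e e0.
have Phi0 : 0 < `|Phi| + 1 by rewrite ltr_wpDl.
(* The 2 absorbs the constant of [dual_indic_dist], and [|Phi| + 1] the norm of [Phi]. *)
have d0 : 0 < e / (`|Phi| + 1) / 2 by rewrite !divr_gt0.
have /cvgrPdist_le/(_ _ d0) near_phi := cx.
apply: filterS near_phi => psi; rewrite distrC => psid.
rewrite distrC -linearB (le_trans (op_norm_ge Phi _))//.
have {psid} := le_trans (dual_indic_dist phi1 (val1 psi) phix)
  (ler_wpM2l (ler0n _ 2) psid).
rewrite mulrC divfK// ler_pdivlMr// mulrC; apply: le_trans.
by rewrite ler_wpM2r// lerDl.
Qed.

End discrete.

Theorem corollary6p9 (R : realType) (L : topologicalType)
    (Lhausdorff : hausdorff_space L)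
    (Lcompact : locally_compact [set: L]) :
  (forall phi : ball_weak_star (C0 R L),
     extreme_points (@unit_ball R (dual (C0 R L))) (set_val phi) ->
     {for phi, continuous (@ball_id R (C0 R L))})
  <-> discrete_space L.
Proof.
split; first exact: continuous_ball_id_discrete.
by move=> dL phi; exact: discrete_continuous_ball_id.
Qed.
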